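(* For any fixed integers $\chi<0$ and $n\ge0$, and any $k\in\mathbb{N}$, one has $r_{\chi,n}^k\le r_{\chi,0}^k<r_A^k$. The inequality $r_{\chi,n}^k\le r_{\chi,0}^k$ is strict if and only if $n>0$.
   Context: For $\chi<0$, $n\ge0$ and $k\in\mathbb{N}$, $r_{\chi,n}^k$ denotes the unique positive solution of $\left(6-\frac{6\chi+3n}{k}\right)\alpha(r_{\chi,n}^k)+\frac{2n}{k}\beta(r_{\chi,n}^k)=2\pi$, where $\alpha(r)=2\sin^{-1}\left(\frac{1}{2\cosh r}\right)$ and $\beta(r)=\sin^{-1}\left(\frac{1}{\cosh r}\right)$. The number $r_A^k>0$ (depending also on $\chi$) is defined by $\cosh(r_A^k)=1-\frac{\chi}{k}$. *)

(* Defs.v *)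
From Stdlib Require Export Reals ZArith.
From Stdlib Require Import ClassicalEpsilon.
Open Scope R_scope.

Definition alpha (r : R) : R := 2 * asin (1 / (2 * cosh r)).

Definition beta (r : R) : R := asin (1 / cosh r).

(* Definite description: [the P] is the unique real satisfying [P]; as with
   any choice operator it carries no information unless [exists! x, P x]. *)
Definition the (P : R -> Prop) : R := epsilon (inhabits 0) (unique P).

Definition r_eq (chi n : Z) (k : nat) (r : R) : Prop :=
  (6 - (6 * IZR chi + 3 * IZR n) / INR k) * alpha r
    + 2 * IZR n / INR k * beta r = 2 * PI.

Definition r_sol (chi n : Z) (k : nat) : R :=
  the (fun r => 0 < r /\ r_eq chi n k r).

Definition r_A (chi : Z) (k : nat) : R :=
  the (fun r => 0 < r /\ cosh r = 1 - IZR chi / INR k).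

(* Main.v *)
Require Import Defs.
From Stdlib Require Import Reals ZArith.
From Stdlib Require Import Lra ClassicalEpsilon.
Open Scope R_scope.

(** Put [x = - chi / k > 0], [y = n / k >= 0] and [c = 1 / cosh r], which
    decreases strictly from 1 to 0 as [r] runs through the positive reals.  The
    left-hand side of the equation defining [r_sol] becomes
    [12 (1 + x) asin (c / 2) + y h(c)], where [h(c) = 2 asin c - 6 asin (c / 2)].

    Both [asin] and [h] vanish at 0 and are strictly convex on [0, 1), so the
    left-hand side divided by [c] is strictly increasing
    ([angle_sum_ratio_lt]).  Hence a point where the left-hand side is below
    [2 PI] lies to the left of every point where it equals [2 PI]
    ([angle_sum_lt_2PI]); in particular the solution is unique.  Existence is
    the intermediate value theorem in the variable [asin c], the value at
    [c = 1] being [2 PI (1 + x)].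

    The two inequalities follow by evaluating the left-hand side.  Let [c0] be
    the solution for [n = 0].  Since [h < 0] on (0, 1) ([angle_defect_neg]), for
    [n > 0] the left-hand side at [c0] is below [2 PI], so the solution for [n]
    is greater than [c0], and [r] is smaller.  The number [r_A] corresponds to
    [c = 1 / (1 + x)], and [asin (c / 2) < c asin (1 / 2) = c PI / 6] shows that
    the left-hand side for [n = 0] is below [2 PI] there. *)

(** * Strictly convex functions vanishing at the origin *)

Lemma ratio_increasing_of_derivative_increasing (f f' : R -> R) (a b : R) :
  f 0 = 0 -> 0 < a < b ->
  (forall c, 0 <= c <= b -> derivable_pt_lim f c (f' c)) ->
  (forall u v, 0 < u < v -> v < b -> f' u < f' v) ->
  f a * b < f b * a.
Proof.
intros f0 Hab Hd Hinc.
destruct (MVT_cor2 f f' 0 a) as [u [Hu Hu']]; [lra| intros; apply Hd; lra |].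
destruct (MVT_cor2 f f' a b) as [v [Hv Hv']]; [lra| intros; apply Hd; lra |].
assert (H : f' u < f' v) by (apply Hinc; lra).
rewrite f0 in Hu.
assert (Ha : f a = f' u * a) by lra.
assert (Hb : f b = f' u * a + f' v * (b - a)) by lra.
rewrite Hb, Ha.
assert (0 < (f' v - f' u) * (a * (b - a))) by
  (apply Rmult_lt_0_compat; [| apply Rmult_lt_0_compat]; lra).
nra.
Qed.

Lemma derivable_pt_lim_asin (c : R) :
  -1 < c < 1 -> derivable_pt_lim asin c (1 / sqrt (1 - c²)).
Proof.
intros Hc. apply (derive_pt_eq_1 _ _ _ (derivable_pt_asin c Hc)), derive_pt_asin.
Qed.

Lemma derivable_pt_lim_asin_half (c : R) :
  -2 < c < 2 -> derivable_pt_lim (fun t => asin (t / 2)) c (1 / sqrt (4 - c²)).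
Proof.
intros Hc.
assert (E : 1 / sqrt (4 - c²) = 1 / sqrt (1 - (c / 2)²) * / 2).
{ replace (4 - c²) with (2² * (1 - (c / 2)²)) by (unfold Rsqr; field).
  assert (0 < 1 - (c / 2)²) by (unfold Rsqr; nra).
  rewrite sqrt_mult by (unfold Rsqr in *; nra). rewrite sqrt_Rsqr by lra.
  field. apply Rgt_not_eq, sqrt_lt_R0; assumption. }
rewrite E.
apply (derivable_pt_lim_comp (fun t => t / 2) asin).
- replace (/ 2) with (1 * / 2) by ring.
  apply (derivable_pt_lim_scal_right id), derivable_pt_lim_id.
- apply derivable_pt_lim_asin; lra.
Qed.

Lemma asin_ratio_lt (a b : R) : 0 < a < b -> b < 1 -> asin a * b < asin b * a.
Proof.
intros Hab Hb.
apply (ratio_increasing_of_derivative_increasing asin (fun c => 1 / sqrt (1 - c²))); auto.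
- apply asin_0.
- intros c Hc. apply derivable_pt_lim_asin; lra.
- intros u v Hu Hv. unfold Rdiv. rewrite !Rmult_1_l.
  apply Rinv_lt_contravar; [apply Rmult_lt_0_compat; apply sqrt_lt_R0 | apply sqrt_lt_1];
  unfold Rsqr; nra.
Qed.

Lemma asin_half : asin (1 / 2) = PI / 6.
Proof.
rewrite <- sin_PI6. apply asin_sin. generalize PI_RGT_0; lra.
Qed.

(** * The angle sum as a function of the reciprocal of cosh *)

(** The quantity [2 beta - 3 alpha] in terms of [c = 1 / cosh r]. *)
Definition angle_defect (c : R) : R := 2 * asin c - 6 * asin (c / 2).

(** With [p = sqrt (1 - c^2)] and [q = sqrt (4 - c^2)], the derivative of
    [angle_defect] is [2 / p - 6 / q].  It increases with [c] because
    [q^2 - p^2] is constant and [q >= 2 p]. *)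
Lemma angle_defect_ratio_lt (a b : R) :
  0 < a < b -> b < 1 -> angle_defect a * b < angle_defect b * a.
Proof.
intros Hab Hb.
apply (ratio_increasing_of_derivative_increasing angle_defect
  (fun c => 2 * (1 / sqrt (1 - c²)) - 6 * (1 / sqrt (4 - c²)))); auto.
- unfold angle_defect. replace (0 / 2) with 0 by field. rewrite asin_0; ring.
- intros c Hc.
  apply derivable_pt_lim_minus.
  + apply (derivable_pt_lim_scal asin), derivable_pt_lim_asin; lra.
  + apply (derivable_pt_lim_scal (fun t => asin (t / 2))), derivable_pt_lim_asin_half; lra.
- intros u v Hu Hv.
  assert (Hpu : 0 < sqrt (1 - u²)) by (apply sqrt_lt_R0; unfold Rsqr; nra).
  assert (Hpv : 0 < sqrt (1 - v²)) by (apply sqrt_lt_R0; unfold Rsqr; nra).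
  assert (Hqu : 0 < sqrt (4 - u²)) by (apply sqrt_lt_R0; unfold Rsqr; nra).
  assert (Hqv : 0 < sqrt (4 - v²)) by (apply sqrt_lt_R0; unfold Rsqr; nra).
  assert (Hp : sqrt (1 - v²) < sqrt (1 - u²)) by (apply sqrt_lt_1; unfold Rsqr; nra).
  assert (Epu := sqrt_sqrt (1 - u²)). assert (Epv := sqrt_sqrt (1 - v²)).
  assert (Equ := sqrt_sqrt (4 - u²)). assert (Eqv := sqrt_sqrt (4 - v²)).
  specialize (Epu ltac:(unfold Rsqr; nra)). specialize (Epv ltac:(unfold Rsqr; nra)).
  specialize (Equ ltac:(unfold Rsqr; nra)). specialize (Eqv ltac:(unfold Rsqr; nra)).
  set (p := sqrt (1 - u²)) in *. set (p' := sqrt (1 - v²)) in *.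
  set (q := sqrt (4 - u²)) in *. set (q' := sqrt (4 - v²)) in *.
  assert (Hsu := Rle_0_sqr u). assert (Hsv := Rle_0_sqr v).
  assert (H1 : 2 * p <= q) by nra.
  assert (H2 : 2 * p' <= q') by nra.
  assert (Hq : q * q - q' * q' = p * p - p' * p') by lra.
  assert (Hqq : 4 * (p * p') <= q * q') by nra.
  assert (Hprod : 8 * (p * p' * (p + p')) <= q * q' * (q + q')).
  { apply Rle_trans with (4 * (p * p') * (2 * (p + p'))); [right; ring |].
    apply Rmult_le_compat; nra. }
  assert (Hpos : 0 < p * p' * (p + p')) by
    (apply Rmult_lt_0_compat; [apply Rmult_lt_0_compat |]; lra).
  assert (Hpp : 0 < p * p') by (apply Rmult_lt_0_compat; lra).
  assert (Hqq' : 0 < q * q') by (apply Rmult_lt_0_compat; lra).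
  apply Rlt_0_minus.
  replace (2 * (1 / p') - 6 * (1 / q') - (2 * (1 / p) - 6 * (1 / q)))
    with (2 * (p - p') * (q * q' * (q + q') - 3 * (p * p' * (p + p')))
          / (p * p' * (q * q') * (q + q'))).
  + apply Rdiv_lt_0_compat; repeat apply Rmult_lt_0_compat; lra.
  + assert (Eq : q - q' = (p - p') * (p + p') / (q + q')).
    { apply (Rmult_eq_reg_r (q + q')); [| lra]. field_simplify; lra. }
    transitivity (2 * ((p - p') / (p * p') - 3 * (q - q') / (q * q'))).
    * rewrite Eq. field. repeat split; lra.
    * field. repeat split; lra.
Qed.

(** If [a = asin (c / 2)], then [sin (3 a) = c + c (1 - c^2) / 2 > c]. *)
Lemma angle_defect_neg (c : R) : 0 < c < 1 -> angle_defect c < 0.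
Proof.
intros Hc. unfold angle_defect.
assert (HPI := PI_RGT_0).
set (a := asin (c / 2)).
assert (Hs : sin a = c / 2) by (apply sin_asin; lra).
assert (Hbd : - (PI / 2) < a < PI / 2) by (apply asin_bound_lt; lra).
assert (Ha0 : 0 < a).
{ apply sin_increasing_0; rewrite ?sin_0, ?Hs; lra. }
assert (Ha6 : a < PI / 6).
{ apply sin_increasing_0; rewrite ?sin_PI6, ?Hs; lra. }
assert (Hbc := asin_bound_lt c ltac:(lra)).
cut (asin c < 3 * a); [lra |].
apply sin_increasing_0; try lra.
rewrite sin_asin by lra.
replace (3 * a) with (2 * a + a) by ring.
rewrite sin_plus, sin_2a, cos_2a.
assert (H1 := sin2_cos2 a). unfold Rsqr in H1.
replace (2 * sin a * cos a * cos a + (cos a * cos a - sin a * sin a) * sin a)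
  with (sin a * (3 - 4 * (sin a * sin a))).
- rewrite Hs. assert (0 < c * (1 - c * c)) by (apply Rmult_lt_0_compat; nra). nra.
- replace (cos a * cos a) with (1 - sin a * sin a) by lra.
  transitivity (sin a * (3 * (1 - sin a * sin a) - sin a * sin a)); [ring |].
  replace (1 - sin a * sin a) with (cos a * cos a) by lra. ring.
Qed.

(** The left-hand side of [r_eq], with [x = - chi / k], [y = n / k] and
    [c = 1 / cosh r]. *)
Definition angle_sum (x y c : R) : R :=
  12 * (1 + x) * asin (c / 2) + y * angle_defect c.

Lemma angle_sum_ratio_lt (x y a b : R) :
  0 < x -> 0 <= y -> 0 < a < b -> b < 1 ->
  angle_sum x y a * b < angle_sum x y b * a.
Proof.
intros Hx Hy Hab Hb. unfold angle_sum.
assert (H1 := angle_defect_ratio_lt a b Hab Hb).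
assert (H2 := asin_ratio_lt (a / 2) (b / 2) ltac:(lra) ltac:(lra)).
assert (0 < (1 + x) * (asin (b / 2) * a - asin (a / 2) * b)) by
  (apply Rmult_lt_0_compat; lra).
assert (0 <= y * (angle_defect b * a - angle_defect a * b)) by
  (apply Rmult_le_pos; lra).
lra.
Qed.

Lemma angle_sum_lt_2PI (x y a b : R) :
  0 < x -> 0 <= y -> 0 < a < 1 -> 0 < b < 1 ->
  angle_sum x y a < 2 * PI -> angle_sum x y b = 2 * PI -> a < b.
Proof.
intros Hx Hy Ha Hb HA HB. assert (HPI := PI_RGT_0).
destruct (Rtotal_order a b) as [H | [H | H]]; [assumption | subst; lra |].
assert (H1 := angle_sum_ratio_lt x y b a Hx Hy ltac:(lra) ltac:(lra)).
rewrite HB in H1. nra.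
Qed.

Lemma angle_sum_eq_2PI_unique (x y a b : R) :
  0 < x -> 0 <= y -> 0 < a < 1 -> 0 < b < 1 ->
  angle_sum x y a = 2 * PI -> angle_sum x y b = 2 * PI -> a = b.
Proof.
intros Hx Hy Ha Hb HA HB. assert (HPI := PI_RGT_0).
destruct (Rtotal_order a b) as [H | [H | H]]; [exfalso | assumption | exfalso].
- assert (H1 := angle_sum_ratio_lt x y a b Hx Hy ltac:(lra) ltac:(lra)).
  rewrite HA, HB in H1. nra.
- assert (H1 := angle_sum_ratio_lt x y b a Hx Hy ltac:(lra) ltac:(lra)).
  rewrite HA, HB in H1. nra.
Qed.

Lemma angle_sum_eq_2PI_exists (x y : R) :
  0 < x -> exists c, 0 < c < 1 /\ angle_sum x y c = 2 * PI.
Proof.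
intros Hx. assert (HPI := PI_RGT_0).
(* In the variable [t = asin c] the angle sum is continuous on the whole line,
   which avoids the singularity of the derivative of [asin] at 1. *)
set (F := fun t => (12 * (1 + x) - 6 * y) * asin (sin t / 2) + 2 * y * t - 2 * PI).
assert (HF : forall t, 0 <= t <= PI / 2 -> F t = angle_sum x y (sin t) - 2 * PI).
{ intros t Ht. unfold F, angle_sum, angle_defect. rewrite asin_sin by lra. ring. }
assert (HFc : continuity F).
{ intros t. apply derivable_continuous_pt.
  apply derivable_pt_minus; [| apply derivable_pt_const].
  apply derivable_pt_plus.
  - apply derivable_pt_scal.
    apply (derivable_pt_comp sin (fun s => asin (s / 2))); [apply derivable_pt_sin |].
    eexists. apply derivable_pt_lim_asin_half. generalize (SIN_bound t); lra.
  - apply derivable_pt_scal, derivable_pt_id. }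
assert (F0 : F 0 = - (2 * PI)).
{ unfold F. rewrite sin_0. replace (0 / 2) with 0 by field. rewrite asin_0. ring. }
assert (F1 : F (PI / 2) = 2 * PI * x).
{ unfold F. rewrite sin_PI2, asin_half. field. }
destruct (IVT F 0 (PI / 2) HFc) as [t [Ht Ft]]; [lra | lra | rewrite F1; nra |].
assert (t <> 0) by (intros ->; lra).
assert (t <> PI / 2) by (intros ->; rewrite F1 in Ft; nra).
exists (sin t). split.
- split; [rewrite <- sin_0 | rewrite <- sin_PI2]; apply sin_increasing_1; lra.
- rewrite HF in Ft by lra. lra.
Qed.

(** * The change of variable given by the hyperbolic cosine *)

Lemma cosh_sqr (r : R) : cosh r * cosh r = 1 + sinh r * sinh r.
Proof.
unfold cosh, sinh.
assert (H : exp r * exp (- r) = 1) by (rewrite <- exp_plus, Rplus_opp_r; apply exp_0).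
field_simplify. nra.
Qed.

Lemma cosh_pos (r : R) : 0 < cosh r.
Proof.
unfold cosh. generalize (exp_pos r) (exp_pos (- r)); lra.
Qed.

Lemma cosh_lt (r s : R) : 0 <= r -> r < s -> cosh r < cosh s.
Proof.
intros Hr Hrs.
assert (H1 := cosh_sqr r). assert (H2 := cosh_sqr s).
assert (H3 := sinh_lt r s Hrs).
assert (H4 := cosh_pos r). assert (H5 := cosh_pos s).
assert (0 <= sinh r).
{ destruct Hr as [Hr | <-]; [| rewrite sinh_0; lra].
  apply Rlt_le. rewrite <- sinh_0. now apply sinh_lt. }
nra.
Qed.

Lemma cosh_gt_1 (r : R) : 0 < r -> 1 < cosh r.
Proof.
intros Hr. rewrite <- cosh_0. apply cosh_lt; lra.
Qed.

Lemma cosh_lt_inv (r s : R) : 0 < s -> cosh r < cosh s -> r < s.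
Proof.
intros Hs H. destruct (Rlt_le_dec r s) as [|[Hsr | <-]]; [assumption | | lra].
assert (H1 := cosh_lt s r ltac:(lra) Hsr). lra.
Qed.

Lemma cosh_inj_pos (r s : R) : 0 < r -> 0 < s -> cosh r = cosh s -> r = s.
Proof.
intros Hr Hs H. destruct (Rtotal_order r s) as [H1 | [H1 | H1]]; [| assumption |];
apply cosh_lt in H1; lra.
Qed.

Lemma cosh_surj (w : R) : 1 < w -> exists r, 0 < r /\ cosh r = w.
Proof.
intros Hw. assert (H0 : 0 < sqrt (w * w - 1)) by (apply sqrt_lt_R0; nra).
exists (arcsinh (sqrt (w * w - 1))). split.
- rewrite <- arcsinh_0. now apply arcsinh_lt.
- assert (H1 := cosh_sqr (arcsinh (sqrt (w * w - 1)))).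
  rewrite sinh_arcsinh, sqrt_sqrt in H1 by nra.
  assert (H2 := cosh_pos (arcsinh (sqrt (w * w - 1)))). nra.
Qed.

Lemma inv_cosh_bounds (r : R) : 0 < r -> 0 < 1 / cosh r < 1.
Proof.
intros Hr. assert (H := cosh_gt_1 r Hr). split.
- apply Rdiv_lt_0_compat; lra.
- apply (Rmult_lt_reg_r (cosh r)); [lra |]. field_simplify; lra.
Qed.

Lemma inv_cosh_lt_inv (r s : R) : 0 < r -> 0 < s -> 1 / cosh r < 1 / cosh s -> s < r.
Proof.
intros Hr Hs H. apply cosh_lt_inv; [assumption |].
unfold Rdiv in H. rewrite !Rmult_1_l in H.
apply Rinv_0_lt_contravar in H; [| apply Rinv_0_lt_compat, cosh_pos].
now rewrite !Rinv_inv in H.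
Qed.

Lemma inv_cosh_inj_pos (r s : R) : 0 < r -> 0 < s -> 1 / cosh r = 1 / cosh s -> r = s.
Proof.
intros Hr Hs H. apply cosh_inj_pos; try assumption.
unfold Rdiv in H. rewrite !Rmult_1_l in H. now apply Rinv_eq_reg.
Qed.

(** * The radii *)

Lemma r_eq_angle_sum (chi n : Z) (k : nat) (r : R) :
  (0 < k)%nat ->
  r_eq chi n k r <-> angle_sum (- IZR chi / INR k) (IZR n / INR k) (1 / cosh r) = 2 * PI.
Proof.
intros hk. unfold r_eq, alpha, beta, angle_sum, angle_defect.
assert (Hk : 0 < INR k) by now apply lt_0_INR.
assert (Hc := cosh_pos r).
replace (1 / cosh r / 2) with (1 / (2 * cosh r)) by (field; lra).
match goal with |- ?a = _ <-> ?b = _ => replace b with a; [reflexivity |] end.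
field; lra.
Qed.

Lemma the_spec (P : R -> Prop) : (exists! x, P x) -> P (the P).
Proof.
intros H. exact (proj1 (epsilon_spec (inhabits 0) (unique P) H)).
Qed.

Lemma r_sol_spec (chi n : Z) (k : nat) :
  (chi < 0)%Z -> (0 <= n)%Z -> (0 < k)%nat ->
  0 < r_sol chi n k /\ r_eq chi n k (r_sol chi n k).
Proof.
intros hchi hn hk. unfold r_sol.
apply (the_spec (fun r => 0 < r /\ r_eq chi n k r)).
assert (Hk : 0 < INR k) by now apply lt_0_INR.
assert (Hx : 0 < - IZR chi / INR k) by
  (apply Rdiv_lt_0_compat; [apply IZR_lt in hchi |]; lra).
assert (Hy : 0 <= IZR n / INR k).
{ apply IZR_le in hn. apply Rmult_le_pos; [assumption |].
  now apply Rlt_le, Rinv_0_lt_compat. }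
destruct (angle_sum_eq_2PI_exists _ (IZR n / INR k) Hx) as [c [Hc Ec]].
destruct (cosh_surj (1 / c)) as [r [Hr Er]].
{ apply (Rmult_lt_reg_r c); [lra |]. field_simplify; lra. }
exists r. split.
- split; [assumption |]. apply r_eq_angle_sum; [assumption |].
  rewrite Er. now replace (1 / (1 / c)) with c by (field; lra).
- intros s [Hs Es]. apply r_eq_angle_sum in Es; [| assumption].
  apply inv_cosh_inj_pos; try assumption.
  apply (angle_sum_eq_2PI_unique _ _ _ _ Hx Hy); auto using inv_cosh_bounds.
  rewrite Er. now replace (1 / (1 / c)) with c by (field; lra).
Qed.

Lemma r_A_spec (chi : Z) (k : nat) :
  (chi < 0)%Z -> (0 < k)%nat ->
  0 < r_A chi k /\ cosh (r_A chi k) = 1 - IZR chi / INR k.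
Proof.
intros hchi hk. unfold r_A.
apply (the_spec (fun r => 0 < r /\ cosh r = 1 - IZR chi / INR k)).
assert (Hk : 0 < INR k) by now apply lt_0_INR.
assert (Hx : 0 < - IZR chi / INR k) by
  (apply Rdiv_lt_0_compat; [apply IZR_lt in hchi |]; lra).
destruct (cosh_surj (1 - IZR chi / INR k)) as [r [Hr Er]]; [lra |].
exists r. split; [now split |].
intros s [Hs Es]. apply cosh_inj_pos; congruence.
Qed.

Lemma r_sol_lt_r_sol_0 (chi n : Z) (k : nat) :
  (chi < 0)%Z -> (0 < n)%Z -> (0 < k)%nat -> r_sol chi n k < r_sol chi 0 k.
Proof.
intros hchi hn hk.
destruct (r_sol_spec chi n k hchi ltac:(auto with zarith) hk) as [Hr Er].
destruct (r_sol_spec chi 0 k hchi ltac:(auto with zarith) hk) as [H0 E0].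
apply r_eq_angle_sum in Er, E0; try assumption.
assert (Hk : 0 < INR k) by now apply lt_0_INR.
assert (Hx : 0 < - IZR chi / INR k) by
  (apply Rdiv_lt_0_compat; [apply IZR_lt in hchi |]; lra).
assert (Hy : 0 < IZR n / INR k) by
  (apply Rdiv_lt_0_compat; [apply IZR_lt in hn |]; lra).
apply inv_cosh_lt_inv; try assumption.
apply (angle_sum_lt_2PI _ _ _ _ Hx (Rlt_le _ _ Hy)); auto using inv_cosh_bounds.
assert (Hd := angle_defect_neg _ (inv_cosh_bounds _ H0)).
replace (0 / INR k) with 0 in E0 by (field; lra).
unfold angle_sum in *. nra.
Qed.

Lemma r_sol_0_lt_r_A (chi : Z) (k : nat) :
  (chi < 0)%Z -> (0 < k)%nat -> r_sol chi 0 k < r_A chi k.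
Proof.
intros hchi hk.
destruct (r_sol_spec chi 0 k hchi ltac:(auto with zarith) hk) as [H0 E0].
destruct (r_A_spec chi k hchi hk) as [HA EA].
apply r_eq_angle_sum in E0; [| assumption].
assert (Hk : 0 < INR k) by now apply lt_0_INR.
assert (Hx : 0 < - IZR chi / INR k) by
  (apply Rdiv_lt_0_compat; [apply IZR_lt in hchi |]; lra).
replace (0 / INR k) with 0 in E0 by (field; lra).
apply inv_cosh_lt_inv; try assumption.
apply (angle_sum_lt_2PI _ 0 _ _ Hx (Rle_refl 0)); auto using inv_cosh_bounds.
assert (HcA := inv_cosh_bounds _ HA).
assert (Hm : (1 + - IZR chi / INR k) * (1 / cosh (r_A chi k)) = 1) by
  (rewrite EA; field; split; [lra | apply IZR_lt in hchi; lra]).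
set (x := - IZR chi / INR k) in *. set (c := 1 / cosh (r_A chi k)) in *.
assert (H := asin_ratio_lt (c / 2) (1 / 2) ltac:(lra) ltac:(lra)).
rewrite asin_half in H.
unfold angle_sum.
assert (H' : (1 + x) * asin (c / 2) < (1 + x) * (PI / 6 * c)) by
  (apply Rmult_lt_compat_l; lra).
replace ((1 + x) * (PI / 6 * c)) with (PI / 6 * ((1 + x) * c)) in H' by ring.
rewrite Hm in H'. lra.
Qed.

Theorem proposition2p3 (chi n : Z) (k : nat)
  (hchi : (chi < 0)%Z) (hn : (0 <= n)%Z) (hk : (0 < k)%nat) :
  r_sol chi n k <= r_sol chi 0 k < r_A chi k /\
  (r_sol chi n k < r_sol chi 0 k <-> (0 < n)%Z).
Proof.
assert (HA := r_sol_0_lt_r_A chi k hchi hk).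
destruct (Z.lt_total 0 n) as [Hn | [<- | Hn]].
- assert (H := r_sol_lt_r_sol_0 chi n k hchi Hn hk).
  repeat split; auto; lra.
- repeat split; auto; try lra. intros H; now apply Z.lt_irrefl in H.
- exfalso. apply (Z.lt_irrefl n). now apply Z.lt_le_trans with 0%Z.
Qed.
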